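(* Let $R$ be a commutative ring with identity, let $n\geq 2$, and let $f,g\in R[X]$ be monic polynomials of degree $n$ with companion matrices $C,D\in M_n(R)$, respectively. Let $M_{f,g}\in M_{n^2}(R)$ be the matrix whose columns are the coordinates of the matrices $C^iD^j$, $0\leq i,j\leq n-1$, relative to the canonical basis of $M_n(R)$ formed by all basic matrices $E^{kl}$, $1\leq k,l\leq n$, where the matrices $C^iD^j$ are listed in the order $$D^{n-1},CD^{n-1},\dots,C^{n-1}D^{n-1},\ D^{n-2},CD^{n-2},\dots,C^{n-1}D^{n-2},\ \dots,\ I,C,\dots,C^{n-1},$$ and the basic matrices are listed in the order $$E^{11},E^{21},\dots,E^{n1},\ \dots,\ E^{1n},E^{2n},\dots,E^{nn}.$$ Let $M(f,g)=\det M_{f,g}$. Then $M(f,g)=R(f,g)^{n-1}$, where $R(f,g)$ is the resultant of $f$ and $g$.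
   Context: The companion matrix of a monic polynomial $f=f_0+f_1X+\cdots+f_{n-1}X^{n-1}+X^n\in R[X]$ is the matrix in $M_n(R)$ whose $j$-th column is $e_{j+1}$ for $1\leq j\leq n-1$ and whose last column is $(-f_0,-f_1,\dots,-f_{n-1})^t$, where $e_1,\dots,e_n$ is the canonical basis of the column space $R^n$. $E^{kl}$ is the $n\times n$ matrix with $1$ in position $(k,l)$ and $0$ elsewhere. The resultant is normalized so that $R(f,g)=\prod_{1\le i,j\le n}(y_i-z_j)$ when $f=\prod_{i=1}^n(X-y_i)$ and $g=\prod_{j=1}^n(X-z_j)$. *)

(* Defs.v *)
From mathcomp Require Import all_boot all_order all_algebra.

Set Implicit Arguments.
Unset Strict Implicit.
Unset Printing Implicit Defensive.

Import GRing.Theory.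
Local Open Scope ring_scope.

(* mxpoly's [companionmx] acts on row vectors and has dimension             *)
(* (size f).-1; this is its transpose, with the dimension n explicit. It is  *)
(* meaningful only for f monic with size f = n.+1.                           *)
Definition companion_col (R : comNzRingType) (n : nat) (f : {poly R}) :
    'M[R]_n :=
  \matrix_(i < n, j < n)
    if j == n.-1 :> nat then - f`_i else (i == j.+1 :> nat)%:R.

Lemma companion_colE (R : comNzRingType) (f : {poly R}) :
  companion_col (size f).-1 f = (companionmx f)^T.
Proof. by apply/matrixP=> i j; rewrite !mxE (eq_sym (i:nat)). Qed.

(* [mxvec] is row-major, so [mxvec A^T] lists the coordinates of A in the    *)
(* column-major order E^11, E^21, ..., E^n1, ..., E^1n, ..., E^nn.           *)
(* Column c = q * n + i, with i < n, comes from C^i D^(n-1-q).               *)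
Definition companion_products_mx (R : comNzRingType) (n : nat)
    (f g : {poly R}) : 'M[R]_(n * n) :=
  let C := companion_col n f in
  let D := companion_col n g in
  \matrix_(r < n * n, c < n * n)
    mxvec (C ^+ (c %% n) *m D ^+ (n.-1 - c %/ n))^T 0 r.

Lemma index_allpairs_pair (S T : eqType) (s : seq S) (t : seq T) x y :
  x \in s -> y \in t ->
  index (x, y) [seq (a, b) | a <- s, b <- t] =
    (index x s * size t + index y t)%N.
Proof.
elim: s => //= a s IH; rewrite inE index_cat => xs yt.
case: (eqVneq a x) => [->|ne].
  by rewrite map_f // index_map // => u v [].
have -> : ((x,y) \in [seq (a,b) | b <- t]) = false.
  by apply/negP=> /mapP[b _ [e _]]; rewrite e eqxx in ne.
move: xs; rewrite eq_sym (negbTE ne) /= => xs.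
by rewrite size_map IH // mulSn addnA.
Qed.

Lemma val_mxvec_index m n (i : 'I_m) (j : 'I_n) :
  val (mxvec_index i j) = (i * n + j)%N.
Proof.
rewrite /mxvec_index /=; set p := (i, j).
have -> : (enum_rank p : nat) = index p (enum {: 'I_m * 'I_n}).
  rewrite -[in RHS](enum_rankK p) (enum_val_nth p) index_uniq ?enum_uniq //.
  by rewrite -cardE ltn_ord.
rewrite enumT unlock /= /prod_enum index_allpairs_pair ?mem_enum //.
by rewrite !index_enum_ord size_enum_ord.
Qed.

Lemma companion_products_mxE (R : comNzRingType) n (f g : {poly R}) (k l i j : 'I_n) :
  companion_products_mx n f g (mxvec_index l k) (mxvec_index (rev_ord j) i)
  = (companion_col n f ^+ i *m companion_col n g ^+ j) k l.
Proof.
rewrite mxE mxvecE mxE !val_mxvec_index /=.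
have n0 : (0 < n)%N by apply: leq_ltn_trans (ltn_ord i).
rewrite modnMDl modn_small // divnMDl // divn_small // addn0.
by congr ((_ *m _ ^+ _) _ _); case: n j {n0 k l i} => [[]//|n] j; rewrite subSS subKn // -ltnS.
Qed.

(* mxpoly's Sylvester matrix lists coefficients by increasing degree, which  *)
(* makes [resultant p q] equal to (-1)^(deg p * deg q) times the usual       *)
(* resultant; exchanging the arguments restores the normalization            *)
(* \prod_(i, j) (y_i - z_j) for f = \prod_i ('X - y_i%:P) and                *)
(* g = \prod_j ('X - z_j%:P).                                                *)
Definition res (R : comNzRingType) (f g : {poly R}) : R := resultant g f.

(* Main.v *)
(* Let x be the class of X in R[X]/(f). Column l of C^i D^j is x^i r(x), where *)
(* r is the remainder of X^(l+j) modulo g, and multiplication by x acts on     *)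
(* R[X]/(f) as C. So the matrix of the C^i D^j is an n x n block matrix whose  *)
(* blocks r_(l+j)(C) lie in the commutative ring R[C]. If X^t = q_t g + r_t,   *)
(* then r_(l+j) = X^l X^j - q_(l+j) g, and q_t = 0 for t < n while q_n = 1, so *)
(* subtracting multiples of block row 0 leaves, up to a cyclic shift of the    *)
(* blocks, a triangular matrix with n - 1 diagonal blocks - g(C). All signs    *)
(* are powers of (-1)^(n(n-1)) = 1. Finally det g(C) is the resultant.         *)

Require Import Defs.
From mathcomp Require Import all_boot all_order all_algebra.
From mathcomp Require Import fingroup perm mxtens.

Set Implicit Arguments.
Unset Strict Implicit.

Import GRing.Theory.
Local Open Scope ring_scope.

(** In the proof [C] and [D] are transposed companion matrices, acting on row vectors: row 0 of p(C)
    holds the coordinates of p modulo f in the basis 1, x, ..., x^(n-1) ([companion_row0X],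
    [companion_row0_horner]), and likewise for [D] and g. The transposed matrix of products is then
    a flattened block matrix. After the cyclic shift, it factors as a block lower unitriangular
    matrix times a block upper triangular one; [flatten_mxM] and [det_flatten_utrig] reduce its
    determinant to powers of det g(C), which [res_companion] identifies with the resultant. *)

Definition flatten_mx (R : Type) (n p q : nat) (B : 'M['M[R]_n]_(p, q)) :
    'M[R]_(p * n, q * n) :=
  \matrix_(r, c) B (mxtens_unindex r).1 (mxtens_unindex c).1
                   (mxtens_unindex r).2 (mxtens_unindex c).2.

Lemma flatten_mxM (R : pzRingType) (n p q r : nat)
    (A : 'M['M[R]_n]_(p, q)) (B : 'M['M[R]_n]_(q, r)) :
  flatten_mx (A *m B) = flatten_mx A *m flatten_mx B.
Proof.
apply/matrixP=> i j; rewrite !mxE summxE.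
under eq_bigr do rewrite mxE.
rewrite pair_big /=.
rewrite [LHS](reindex (@mxtens_unindex q n)) /=; last first.
  by exists (@mxtens_index q n) => k _; rewrite (mxtens_indexK, mxtens_unindexK).
by apply: eq_bigr => k _; rewrite !mxE.
Qed.

Section FlattenDet.
Variables (R : comNzRingType) (n p : nat) (B : 'M['M[R]_n]_(1 + p)).

(** The size [(1 + p) * n] computes to [n + p * n], so the flattened matrix splits into scalar
    blocks without a cast. *)
Let A : 'M[R]_(n + p * n) := flatten_mx B.

Let unindex_lshift (k : 'I_n) :
  mxtens_unindex (lshift (p * n) k : 'I_(p.+1 * n)) = (ord0, k).
Proof.
have -> : (lshift (p * n) k : 'I_(p.+1 * n)) = mxtens_index (ord0, k).
  exact: val_inj.
exact: mxtens_indexK.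
Qed.

Let unindex_rshift (r : 'I_(p * n)) :
  mxtens_unindex (rshift n r : 'I_(p.+1 * n)) =
  (lift ord0 (mxtens_unindex r).1, (mxtens_unindex r).2).
Proof.
rewrite -[RHS]mxtens_indexK; congr mxtens_unindex; apply: val_inj => /=.
by rewrite /bump /= mulnDl mul1n -addnA -divn_eq.
Qed.

Let ulA : ulsubmx A = B ord0 ord0.
Proof. by apply/matrixP=> i j; rewrite !mxE !unindex_lshift. Qed.

Let drA : drsubmx A = flatten_mx (drsubmx B).
Proof. by apply/matrixP=> i j; rewrite !mxE !unindex_rshift !rshift1. Qed.

Lemma det_flatten_lblock :
  (forall j, B ord0 (lift ord0 j) = 0) ->
  \det (flatten_mx B) =
  \det (B ord0 ord0) * \det (flatten_mx (drsubmx B)).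
Proof.
move=> B0; rewrite -[X in \det X]/A -[A in LHS]submxK ulA drA.
suff -> : ursubmx A = 0 by rewrite det_lblock.
by apply/matrixP=> i j; rewrite !mxE unindex_lshift unindex_rshift B0 mxE.
Qed.

Lemma det_flatten_ublock :
  (forall i, B (lift ord0 i) ord0 = 0) ->
  \det (flatten_mx B) =
  \det (B ord0 ord0) * \det (flatten_mx (drsubmx B)).
Proof.
move=> B0; rewrite -[X in \det X]/A -[A in LHS]submxK ulA drA.
suff -> : dlsubmx A = 0 by rewrite det_ublock.
by apply/matrixP=> i j; rewrite !mxE unindex_lshift unindex_rshift B0 mxE.
Qed.

End FlattenDet.

Lemma det_flatten_utrig (R : comNzRingType) (n p : nat) (B : 'M['M[R]_n]_p) :
  (forall i j : 'I_p, (j < i)%N -> B i j = 0) ->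
  \det (flatten_mx B) = \prod_i \det (B i i).
Proof.
elim: p B => [|p IH] B B0; first by rewrite big_ord0 det_mx00.
rewrite det_flatten_ublock => [|j]; last exact: B0.
rewrite big_ord_recl IH => [|i j ij]; last by rewrite !mxE B0 // !rshift1.
by congr (_ * _); apply: eq_bigr => i _; rewrite !mxE !rshift1.
Qed.

(** * Cyclic shifts and matrix powers *)

Lemma iter_ordS_expg (N k : nat) (i : 'I_N) :
  (perm (@ordS_inj N) ^+ k)%g i = ((i + k) %% N)%N :> nat.
Proof.
elim: k i => [|k IH] i; first by rewrite expg0 perm1 addn0 modn_small.
by rewrite expgS permM IH permE /= modnDml addSnnS.
Qed.

Lemma odd_perm_expg (T : finType) (s : {perm T}) (k : nat) :
  odd_perm (s ^+ k)%g = odd k && odd_perm s.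
Proof.
elim: k => [|k IH]; first by rewrite expg0 odd_perm1.
by rewrite expgS odd_permM IH /=; case: (odd k); case: (odd_perm s).
Qed.

Lemma horner_mx_sum (R : comNzRingType) (n d : nat) (A : 'M[R]_n.+1)
    (p : {poly R}) :
  (size p <= d)%N -> horner_mx A p = \sum_(i < d) p`_i *: A ^+ i.
Proof.
move=> sp; rewrite -[p in LHS](coefK p) poly_def linear_sum /=.
under eq_bigr do rewrite linearZ /= rmorphXn /= horner_mx_X.
rewrite (big_ord_widen _ (fun i => p`_i *: A ^+ i) sp).
rewrite [LHS]big_mkcond; apply: eq_bigr => i _; case: ltnP => // /leq_sizeP->//.
by rewrite scale0r.
Qed.

Lemma trmx_expr (R : comPzRingType) (n k : nat) (A : 'M[R]_n) :
  (A ^+ k)^T = A^T ^+ k.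
Proof.
elim: k => [|k IH]; first by rewrite !expr0 trmx1.
rewrite exprSr exprS -IH; exact: trmx_mul.
Qed.

(** * Companion matrices as multiplication by x on R[X]/(f) *)

Section Companion.
Variables (R : comNzRingType) (n : nat) (f : {poly R}).
Hypotheses (f_monic : f \is monic) (f_deg : size f = n.+2).
Let C : 'M[R]_n.+1 := (companion_col n.+1 f)^T.

Lemma companion_row0X (k : 'I_n.+1) : row ord0 (C ^+ k) = delta_mx 0 k.
Proof.
case: k => k; elim: k => [|k IH] kn.
  by rewrite expr0 row1; congr delta_mx; apply: val_inj.
have {}IH := IH (ltnW kn).
rewrite exprSr row_mul IH -rowE; apply/rowP=> j; rewrite !mxE /=.
by rewrite ltn_eqF //; congr ((_ : bool)%:R); apply/eqP/eqP => [/val_inj|->].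
Qed.

(** Hence a matrix commuting with [C] is determined by its row 0. *)
Lemma companion_rowX (k : 'I_n.+1) (A : 'M[R]_n.+1) :
  row ord0 (C ^+ k *m A) = row k A.
Proof. by rewrite row_mul companion_row0X -rowE. Qed.

Lemma companion_row0_horner (p : {poly R}) :
  (size p <= n.+1)%N -> row ord0 (horner_mx C p) = poly_rV p.
Proof.
move=> sp; rewrite (horner_mx_sum _ sp) linear_sum /=.
apply/rowP=> j; rewrite summxE (bigD1 j) //= big1 => [|i ij].
  by rewrite addr0 linearZ /= companion_row0X !mxE !eqxx mulr1.
by rewrite linearZ /= companion_row0X !mxE eq_sym (negPf ij) andbF mulr0.
Qed.

(** Row 0 of C^(n+1) is the last row of [C], which cancels the lower terms of f. The other rows
    vanish because f(C) commutes with the powers of [C]. *)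
Lemma horner_companion : horner_mx C f = 0.
Proof.
have f1 : f`_n.+1 = 1 by move/monicP: f_monic; rewrite lead_coefE f_deg.
have rowf0 : row ord0 (horner_mx C f) = 0.
  rewrite (@horner_mx_sum _ _ n.+2) ?f_deg // linear_sum big_ord_recr /= f1.
  rewrite scale1r exprSr row_mul (companion_row0X ord_max) -rowE.
  apply/rowP=> j; rewrite !mxE /= summxE (bigD1 j) //= big1 => [|i ij].
    rewrite eqxx addr0 linearZ /= companion_row0X !mxE !eqxx mulr1.
    by rewrite subrr.
  by rewrite linearZ /= companion_row0X !mxE eq_sym (negPf ij) andbF mulr0.
apply/row_matrixP=> i; rewrite -companion_rowX.
have -> : C ^+ i *m horner_mx C f = horner_mx C f *m C ^+ i.
  have -> : C ^+ i = horner_mx C 'X^i by rewrite rmorphXn /= horner_mx_X.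
  exact: comm_horner_mx2.
by rewrite row_mul [row _ _]rowf0 mul0mx row0.
Qed.

Lemma horner_companion_rmodp (p : {poly R}) :
  horner_mx C (Pdiv.Ring.rmodp p f) = horner_mx C p.
Proof.
rewrite [p in RHS](Pdiv.RingMonic.rdivp_eq f_monic) rmorphD rmorphM /=.
by rewrite horner_companion mulr0 add0r.
Qed.

End Companion.

(** * The resultant as the determinant of g(C) *)

Lemma det_castmx (R : comPzRingType) (m n : nat) (e : m = n) (A : 'M[R]_m) :
  \det (castmx (e, e) A) = \det A.
Proof. by case: n / e. Qed.

Lemma res_companion (R : comNzRingType) (n : nat) (f g : {poly R}) :
  f \is monic -> size f = n.+2 -> size g = n.+2 ->
  res f g = \det (horner_mx (companion_col n.+1 f)^T g).
Proof.
move=> f_monic f_deg g_deg; set C := _^T.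
pose band (p : {poly R}) := \matrix_(i < n.+1, j < n.+1 + n.+1) ('X^i * p)`_j.
have e : ((size f).-1 + (size g).-1 = n.+1 + n.+1)%N by rewrite f_deg g_deg.
rewrite /res /resultant -(det_castmx e).
have -> : castmx (e, e) (Sylvester_mx g f) = col_mx (band g) (band f).
  apply/matrixP=> i j; rewrite castmxE Sylvester_mxE [RHS]mxE.
  case: splitP => k /= ik; case: splitP => k' /= ik'.
  - have -> : k = k' :> nat by rewrite -ik.
    by rewrite mxE coefXnM ltnNge; case: leqP.
  - by move: (ltn_ord k); rewrite -ik ik' f_deg ltnNge leq_addr.
  - by move: (ltn_ord k'); rewrite -ik' ik f_deg ltnNge leq_addr.
  - have -> : k = k' :> nat by apply/eqP; rewrite -(eqn_add2l n.+1) -ik' ik f_deg.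
    by rewrite mxE coefXnM ltnNge; case: leqP.
(* Right multiplication by K replaces the low coefficients of a polynomial by *)
(* those of its remainder modulo f and keeps the high ones.                   *)
pose low := \matrix_(k < n.+1 + n.+1) row ord0 (C ^+ k).
pose K : 'M_(n.+1 + n.+1) := row_mx low (col_mx 0 1%:M).
have bandK (p : {poly R}) : (size p <= n.+2)%N -> band p *m low = horner_mx C p.
  move=> sp; apply/row_matrixP=> i.
  rewrite -[RHS](companion_rowX f) -/C.
  have -> : C ^+ i *m horner_mx C p = horner_mx C ('X^i * p).
    by rewrite rmorphM rmorphXn /= horner_mx_X.
  rewrite (@horner_mx_sum _ _ (n.+1 + n.+1)); last first.
    apply: leq_trans (size_polyMleq _ _) _; rewrite size_polyXn /=.
    by rewrite [leqRHS]addSnnS leq_add // -ltnS.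
  rewrite row_mul mulmx_sum_row linear_sum; apply: eq_bigr => j _.
  by rewrite !mxE rowK linearZ.
(* The top half of [low] is the identity, since row 0 of C^k is the k-th basis vector for k at most
   n. *)
have detK : \det K = 1.
  have -> : K = block_mx 1%:M 0 (dsubmx low) 1%:M.
    rewrite block_mxEh /K -[X in row_mx X _ = _]vsubmxK; congr (row_mx (col_mx _ _) _).
    apply/row_matrixP=> i; rewrite row1 -(companion_row0X f i).
    by apply/rowP=> j; rewrite !mxE.
  by rewrite det_lblock !det1 mulr1.
rewrite -[LHS]mulr1 -detK -det_mulmx mul_mx_row !mul_col_mx.
rewrite !bandK ?f_deg ?g_deg // horner_companion //.
have high p : band p *m col_mx 0 1%:M = rsubmx (band p).
  by rewrite -[band p in LHS]hsubmxK mul_row_col mulmx0 add0r mulmx1.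
rewrite !high -block_mxEh det_ublock.
(* The high part of the f-band is lower triangular, with the leading coefficient 1 of f on its
   diagonal. *)
have coef_high (i j : 'I_n.+1) : rsubmx (band f) i j = f`_(n.+1 + j - i).
  by rewrite !mxE coefXnM ltnNge /= (leq_trans (ltnW (ltn_ord i))) ?leq_addr.
rewrite [X in _ * X]det_trig; last first.
  apply/is_trig_mxP=> i j ij; rewrite coef_high nth_default // f_deg.
  by rewrite -(addnBA _ (ltnW ij)) -[leqLHS]addn1 leq_add2l subn_gt0.
rewrite big1 ?mulr1 // => i _; rewrite coef_high addnK.
by move/monicP: f_monic; rewrite lead_coefE f_deg.
Qed.

Theorem theorem10p1 (R : comNzRingType) (n : nat) (n_ge2 : (2 <= n)%N)
    (f g : {poly R})
    (f_monic : f \is monic) (f_deg : size f = n.+1)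
    (g_monic : g \is monic) (g_deg : size g = n.+1) :
  \det (companion_products_mx n f g) = res f g ^+ n.-1.
Proof.
case: n n_ge2 f_deg g_deg => // m _ f_deg g_deg.
pose n := m.+1; rewrite -/n in f_deg g_deg *.
pose C : 'M[R]_n := (companion_col n f)^T.
pose D : 'M[R]_n := (companion_col n g)^T.
pose phi := horner_mx C.
pose rho k := phi (Pdiv.Ring.rmodp 'X^k g).
(* Row l of D^j is row 0 of D^(l+j), that is, the coefficients of the remainder of X^(l+j) modulo g;
   the same coefficients form row 0 of [rho (l + j)], which commutes with C^i. *)
have entry (l j i k : 'I_n) : (D ^+ j *m C ^+ i) l k = rho (l + j)%N i k.
  suff : row l (D ^+ j *m C ^+ i) = row i (rho (l + j)%N).
    by move/rowP/(_ k); rewrite !mxE.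
  rewrite -[RHS](companion_rowX f) -/C.
  have -> : C ^+ i *m rho (l + j)%N = rho (l + j)%N *m C ^+ i.
    have -> : C ^+ i = phi 'X^i by rewrite /phi rmorphXn /= horner_mx_X.
    exact: comm_horner_mx2.
  rewrite !row_mul; congr (_ *m _).
  rewrite companion_row0_horner; last first.
    by rewrite -ltnS -g_deg Pdiv.Ring.ltn_rmodpN0 // monic_neq0.
  rewrite -(companion_row0_horner g); last first.
    by rewrite -ltnS -g_deg Pdiv.Ring.ltn_rmodpN0 // monic_neq0.
  rewrite horner_companion_rmodp // rmorphXn /= horner_mx_X exprD.
  exact/esym/companion_rowX.
pose N : 'M['M[R]_n]_n := \matrix_(q, l) rho (l + (n.-1 - q))%N.
have defM : (companion_products_mx n f g)^T = flatten_mx N.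
  apply/matrixP=> r c; case: (mxtens_indexP r) => q i.
  case: (mxtens_indexP c) => l k.
  rewrite mxE [RHS]mxE !mxtens_indexK [N _ _]mxE /=.
  have mxtensE (a b : 'I_n) : mxtens_index (a, b) = mxvec_index a b.
    by apply: val_inj; rewrite val_mxvec_index.
  rewrite !mxtensE; move: (companion_products_mxE f g k l i (rev_ord q)).
  rewrite rev_ordK => ->; have := entry l (rev_ord q) i k; rewrite /= subSS => <-.
  transitivity ((companion_col n f ^+ i *m companion_col n g ^+ rev_ord q)^T l k).
    by rewrite [RHS]mxE.
  by rewrite trmx_mul !trmx_expr.
have -> : res f g = \det (phi g) by apply: res_companion.
rewrite -det_tr defM.
(* Shifting by the even number n(n-1) positions moves the last block row, *)
(* which comes from j = 0, to the front.                                  *)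
pose s : 'S_(n * n) := (perm (@ordS_inj (n * n)) ^+ (n * m))%g.
have -> : \det (flatten_mx N) = \det (row_perm s (flatten_mx N)).
  rewrite row_permE det_mulmx det_perm odd_perm_expg oddM /=.
  by rewrite andNb expr0 mul1r.
(* The exponent of [D] in block row p after the shift: 0 for p = 0, and n - p otherwise. *)
pose k (p : 'I_n) := ((n - p) %% n)%N.
pose N' : 'M['M[R]_n]_n := \matrix_(p, l) rho (l + k p)%N.
have -> : row_perm s (flatten_mx N) = flatten_mx N'.
  apply/matrixP=> r c; case: (mxtens_indexP r) => p i.
  case: (mxtens_indexP c) => l j.
  pose q : 'I_n := Ordinal (ltn_pmod (p + m) (ltn0Sn m)).
  have sE : s (mxtens_index (p, i)) = mxtens_index (q, i).
    apply: val_inj; rewrite [LHS]iter_ordS_expg -[RHS](modn_small (ltn_ord _)) /=.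
    rewrite addnAC [(n * m)%N]mulnC -mulnDl [in LHS](divn_eq (p + m) n).
    by rewrite mulnDl -mulnA -addnA modnMDl.
  rewrite mxE sE !mxE !mxtens_indexK /= /k /=.
  congr (rho (l + _)%N i j); case: (p : nat) (ltn_ord p) => [|p'] p_lt.
    by rewrite add0n modn_small // subnn subn0 modnn.
  by rewrite addSnnS modnDr !modn_small ?subSS // ltnS ?leq_subr // ltnW.
have rhoE t : rho t = phi 'X^t - phi (Pdiv.Ring.rdivp 'X^t g) * phi g.
  rewrite [in phi 'X^t](Pdiv.RingMonic.rdivp_eq g_monic 'X^t) /rho.
  by rewrite /phi rmorphD rmorphM /= addrAC subrr add0r.
have quo_small t : (t < n)%N -> Pdiv.Ring.rdivp 'X^t g = 0.
  by move=> tn; rewrite Pdiv.Ring.rdivp_small // size_polyXn g_deg.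
have quo_n : Pdiv.Ring.rdivp 'X^n g = 1.
  rewrite -[in LHS](subrK g 'X^n) addrC -{1}[g]mul1r.
  apply: Pdiv.RingMonic.rdivp_addl_mul_small => //; rewrite g_deg ltnS.
  apply/leq_sizeP=> j; rewrite leq_eqVlt coefB coefXn => /predU1P[<-|n_lt_j].
    by move/monicP: g_monic; rewrite lead_coefE g_deg eqxx => ->; rewrite subrr.
  by rewrite gtn_eqF // nth_default ?subrr // g_deg.
(* [L] undoes the elimination: it adds C^(k p) times block row 0 of [S] to block row p, for p >
   0. *)
pose L : 'M['M[R]_n]_n :=
  \matrix_(p, l) if l == ord0 then phi 'X^(k p) else (p == l)%:R.
pose S : 'M['M[R]_n]_n :=
  \matrix_(p, l) if p == ord0 then phi 'X^l
                 else - (phi (Pdiv.Ring.rdivp 'X^(l + k p) g) * phi g).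
have k0 : k ord0 = 0%N by rewrite /k subn0 modnn.
have kS (p : 'I_m) : k (lift ord0 p) = (m - p)%N.
  by rewrite /k /= /bump /= subSS modn_small // ltnS leq_subr.
have -> : N' = L *m S.
  apply/matrixP=> p l; rewrite !mxE big_ord_recl !mxE /= rhoE addnC.
  rewrite -[phi 'X^(k p) * phi 'X^l]rmorphM -exprD; congr (_ + _).
  case: (unliftP ord0 p) => [p' ->|->].
    rewrite (bigD1 p') //= big1 => [|i ip]; rewrite !mxE /=.
      by rewrite eqxx mul1r addr0 [(k _ + _)%N]addnC.
    by rewrite (inj_eq lift_inj) eq_sym (negPf ip) mul0r.
  rewrite big1 => [|i _]; last by rewrite !mxE /= mul0r.
  by rewrite k0 add0n quo_small // /phi rmorph0 mul0r oppr0.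
rewrite flatten_mxM det_mulmx.
have -> : \det (flatten_mx L) = 1.
  rewrite det_flatten_lblock => [|j]; last by rewrite mxE.
  rewrite mxE /= k0 expr0 /phi rmorph1 det1 mul1r.
  rewrite det_flatten_utrig => [|i j ij]; last first.
    by rewrite !mxE !rshift1 /= (inj_eq lift_inj) -val_eqE /= gtn_eqF.
  by rewrite big1 // => i _; rewrite !mxE !rshift1 /= eqxx det1.
rewrite mul1r det_flatten_ublock => [|p]; last first.
  rewrite mxE /= kS quo_small ?ltnS ?leq_subr //.
  by rewrite /phi rmorph0 mul0r oppr0.
rewrite mxE /= expr0 {1}/phi rmorph1 det1 mul1r.
(* Below the diagonal the exponent stays under n, so the quotient is 0; on the diagonal it is
   exactly n, so the quotient is 1. *)
rewrite det_flatten_utrig => [|p l lp]; last first.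
  rewrite !mxE !rshift1 /= kS quo_small; last first.
    rewrite /bump /= add1n addSn ltnS -[ltnRHS](subnKC (ltnW (ltn_ord p))).
    by rewrite ltn_add2r.
  by rewrite /phi rmorph0 mul0r oppr0.
rewrite (eq_bigr (fun=> \det (- phi g))) => [|p _]; last first.
  rewrite !mxE !rshift1 /= kS /bump /= add1n addSn subnKC ?quo_n; last exact: ltnW.
  by rewrite /phi rmorph1 mul1r.
(* The m blocks of size n contribute the sign (-1)^(n m), which is 1 since n = m + 1. *)
rewrite prodr_const card_ord -scaleN1r detZ exprMn -exprM.
by rewrite -signr_odd oddM /= andNb expr0 mul1r.
Qed.
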